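(* Let $(X,\mu)$ be a non-atomic $\sigma$-finite measure space, $\mathcal H$ a separable Hilbert space, and $\{\phi_t\}_{t\in X}$ a continuous Bessel family in $\mathcal H$. Then for every measurable function $\tau:X\to[0,1]$ and every $\varepsilon>0$ there exists a measurable set $E\subset X$ such that $$\|S_{\phi,E}-S_{\sqrt{\tau}\phi,X}\|<\varepsilon.$$
   Context: A family $\{\phi_t\}_{t\in X}$ of vectors in $\mathcal H$ is a continuous Bessel family (with bound $B$) over the measure space $(X,\mu)$ if (i) for each $f\in\mathcal H$ the function $t\mapsto\langle f,\phi_t\rangle$ is measurable, and (ii) there is $B<\infty$ with $\int_X|\langle f,\phi_t\rangle|^2\,d\mu(t)\le B\|f\|^2$ for all $f\in\mathcal H$. For measurable $E\subset X$, the partial frame operator is $S_{\phi,E}f=\int_E\langle f,\phi_t\rangle\phi_t\,d\mu(t)$, and for measurable $\tau:X\to[0,1]$ the weighted frame operator is $S_{\sqrt{\tau}\phi,X}f=\int_X\tau(t)\langle f,\phi_t\rangle\phi_t\,d\mu(t)$ (integrals defined weakly), $f\in\mathcal H$. Norms of operators are operator norms. *)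

(* Defs.v *)
From HB Require Import structures.
From mathcomp Require Import all_boot all_order all_algebra.
From mathcomp Require Import all_classical all_reals all_analysis.
From mathcomp Require Import complex.
Set Implicit Arguments. Unset Strict Implicit. Unset Printing Implicit Defensive.
Import Order.TTheory GRing.Theory Num.Theory.
Local Open Scope classical_set_scope.
Local Open Scope ring_scope.

Section Hilbert.
Variable R : realType.

Definition ipnorm (V : Type) (ip : V -> V -> R[i]) (x : V) : R :=
  Num.sqrt (complex.Re (ip x x)).

Record hilbert_space (V : lmodType R[i]) := HilbertSpace {
  ip : V -> V -> R[i];
  ip_linear : forall (a : R[i]) (x y z : V), ip (a *: x + y) z = a * ip x z + ip y z;
  ip_conj : forall x y : V, ip y x = Num.conj (ip x y);
  ip_ge0 : forall x : V, 0 <= ip x x;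
  ip_eq0 : forall x : V, ip x x = 0 -> x = 0;
  ip_complete : forall u : nat -> V,
    (forall e : R, 0 < e -> exists N : nat, forall m n : nat, (N <= m)%N -> (N <= n)%N ->
        ipnorm ip (u m - u n) < e) ->
    exists l : V, forall e : R, 0 < e -> exists N : nat, forall n : nat, (N <= n)%N ->
        ipnorm ip (u n - l) < e
}.

Definition hnorm (V : lmodType R[i]) (H : hilbert_space V) (x : V) : R := ipnorm (ip H) x.

Definition separable (V : lmodType R[i]) (H : hilbert_space V) : Prop :=
  exists e : nat -> V, forall (x : V) (eps : R), 0 < eps -> exists n : nat, hnorm H (x - e n) < eps.

Definition opnorm (V : lmodType R[i]) (H : hilbert_space V) (T : V -> V) : \bar R :=
  ereal_sup [set (hnorm H (T f))%:E | f in [set f | hnorm H f <= 1]].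

Context {d : measure_display} {X : measurableType d}.

Definition cmeasurable (f : X -> R[i]) : Prop :=
  measurable_fun setT (fun t => complex.Re (f t)) /\ measurable_fun setT (fun t => complex.Im (f t)).

Definition cintegral (mu : {measure set X -> \bar R}) (D : set X) (f : X -> R[i]) : R[i] :=
  complex.Complex (Rintegral mu D (fun t => complex.Re (f t)))
                  (Rintegral mu D (fun t => complex.Im (f t))).

Definition csqnorm (z : R[i]) : R := complex.Re z ^+ 2 + complex.Im z ^+ 2.

Definition bessel_family (V : lmodType R[i]) (H : hilbert_space V)
    (mu : {measure set X -> \bar R}) (phi : X -> V) : Prop :=
  (forall f : V, cmeasurable (fun t => ip H f (phi t))) /\
  exists B : R, forall f : V,
    (\int[mu]_(t in setT) (csqnorm (ip H f (phi t)))%:E <= (B * hnorm H f ^+ 2)%:E)%E.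

Definition nonatomic (mu : {measure set X -> \bar R}) : Prop :=
  forall A : set X, measurable A -> (0 < mu A)%E ->
    exists B : set X, [/\ measurable B, B `<=` A, (0 < mu B)%E & (0 < mu (A `\` B))%E].

Definition partial_frame_op (V : lmodType R[i]) (H : hilbert_space V)
    (mu : {measure set X -> \bar R}) (phi : X -> V) (E : set X) (f : V) : V :=
  xget 0 [set g : V | forall h : V,
    ip H g h = cintegral mu E (fun t => ip H f (phi t) * ip H (phi t) h)].

(* weighted frame operator S_{sqrt(tau) phi, X}, defined weakly:
   <S f, h> = \int_X tau(t) <f,phi_t><phi_t,h> dmu(t) for all h *)
Definition weighted_frame_op (V : lmodType R[i]) (H : hilbert_space V)
    (mu : {measure set X -> \bar R}) (phi : X -> V) (tau : X -> R) (f : V) : V :=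
  xget 0 [set g : V | forall h : V,
    ip H g h = cintegral mu setT (fun t => ((tau t)%:C)%C * ip H f (phi t) * ip H (phi t) h)].

End Hilbert.

(* Main.v *)
(* On a piece P of finite measure on which [phi] stays close to a fixed vector v, choose,
   by Sierpinski's theorem for non-atomic measures, a set E inside P with
   mu E = \int_P tau: then \int_P (1_E - tau) <f,v><v,h> = 0, and only the error made in
   replacing [phi t] by v remains. Separability and sigma-finiteness cut X into countably
   many such pieces, chosen so fine that the errors add up to less than eps. *)
Require Import Defs.
From HB Require Import structures.
From mathcomp Require Import all_boot all_order all_algebra.
From mathcomp Require Import all_classical all_reals all_analysis.
From mathcomp Require Import measurable_realfun.
From mathcomp Require Import complex ring lra.
Set Implicit Arguments. Unset Strict Implicit. Unset Printing Implicit Defensive.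
Import Order.TTheory GRing.Theory Num.Theory.
Local Open Scope classical_set_scope.
Local Open Scope ring_scope.

(** * Real inner product and Riesz representation *)

(** Evaluating the quadratic at its minimiser [- b / c] gives the bound. It serves Cauchy-Schwarz
    and the estimate near a minimiser in [riesz]. *)
Lemma quadratic_ge0_discr (R : realType) (a b c : R) : 0 <= c ->
  (forall t, 0 <= a + 2 * t * b + t ^+ 2 * c) -> b ^+ 2 <= a * c.
Proof.
move=> c0 h; have [cE|c_neq0] := eqVneq c 0.
  rewrite cE mulr0; have [->|b0] := eqVneq b 0; first by rewrite expr0n.
  (* With [c = 0] the quadratic is affine in [t], and at this [t] it equals -1. *)
  have := h (- (a + 1) / (2 * b)).
  rewrite cE (_ : _ + _ = -1); last by field.
  by rewrite lerNr oppr0 ler10.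
have cp : 0 < c by rewrite lt0r c_neq0.
have := h (- b / c); rewrite (_ : _ + _ = a - b ^+ 2 / c); last by field.
by rewrite subr_ge0 ler_pdivrMr.
Qed.

Section RealInnerProduct.
Context {R : realType} {V : lmodType R[i]} (H : hilbert_space V).
Implicit Types (x y z f h : V) (r : R) (c : R[i]).

(** A real inner product with the same norm; [Im_ip] recovers the imaginary part from it, so the
    estimates can be made over [R]. *)
Definition rip x y : R := complex.Re (ip H x y).

Lemma ipDl x y z : ip H (x + y) z = ip H x z + ip H y z.
Proof. by rewrite -[x in LHS]scale1r ip_linear mul1r. Qed.

Lemma ip0l z : ip H 0 z = 0.
Proof. by apply: (addIr (ip H 0 z)); rewrite -ipDl !add0r. Qed.

Lemma ipZl c x z : ip H (c *: x) z = c * ip H x z.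
Proof. by rewrite -[c *: x]addr0 ip_linear ip0l addr0. Qed.

Lemma ipE x y : ip H y x = complex.Complex (complex.Re (ip H x y)) (- complex.Im (ip H x y)).
Proof. by rewrite ip_conj; case: (ip H x y). Qed.

Lemma ipBl x y z : ip H (x - y) z = ip H x z - ip H y z.
Proof. by rewrite -scaleN1r ipDl ipZl mulN1r. Qed.

Lemma ipBr x y z : ip H z (x - y) = ip H z x - ip H z y.
Proof.
rewrite ipE ipBl (ipE x z) (ipE y z); case: (ip H x z) (ip H y z) => a b [a' b'].
by apply/eqP; rewrite eq_complex /=; apply/andP; split; apply/eqP; ring.
Qed.

Lemma ripC x y : rip x y = rip y x.
Proof. by rewrite /rip ipE. Qed.

Lemma ripDl x y z : rip (x + y) z = rip x z + rip y z.
Proof. by rewrite /rip ipDl; case: (ip H x z) (ip H y z) => a b []. Qed.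

Lemma ripZl r x z : rip (r%:C%C *: x) z = r * rip x z.
Proof. by rewrite /rip ipZl; case: (ip H x z) => a b /=; rewrite mul0r subr0. Qed.

Lemma ripNl x z : rip (- x) z = - rip x z.
Proof.
by apply/eqP; rewrite -addr_eq0 -ripDl addNr /rip ip0l.
Qed.

Lemma ripDr x y z : rip z (x + y) = rip z x + rip z y.
Proof. by rewrite ripC ripDl !(ripC z). Qed.

Lemma ripZr r x z : rip z (r%:C%C *: x) = r * rip z x.
Proof. by rewrite ripC ripZl ripC. Qed.

Lemma ripNr x z : rip z (- x) = - rip z x.
Proof. by rewrite ripC ripNl ripC. Qed.

Lemma Im_ip x y : complex.Im (ip H x y) = rip x ((complex.Complex 0 1) *: y).
Proof.
rewrite ripC /rip ipZl ipE; case: (ip H y x) => a b /=.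
by rewrite mul0r mul1r sub0r.
Qed.

Lemma hnorm_ge0 x : 0 <= hnorm H x.
Proof. exact: sqrtr_ge0. Qed.
Hint Resolve hnorm_ge0 : core.

Lemma hnorm_sqr x : hnorm H x ^+ 2 = rip x x.
Proof.
by rewrite sqr_sqrtr//; have := ip_ge0 H x; rewrite lecE => /andP[].
Qed.

Lemma hnorm_opp x : hnorm H (- x) = hnorm H x.
Proof.
by apply/eqP; rewrite -(@eqrXn2 _ 2)// !hnorm_sqr ripNl ripNr opprK.
Qed.

Lemma hnorm_subC x y : hnorm H (x - y) = hnorm H (y - x).
Proof. by rewrite -hnorm_opp opprB. Qed.

Lemma ip_self x : ip H x x = (hnorm H x ^+ 2)%:C%C.
Proof.
rewrite hnorm_sqr /rip; have := ip_ge0 H x; rewrite lecE => /andP[/eqP/= + _].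
by case: (ip H x x) => a b /= ->.
Qed.

Lemma hnorm_sqr_scale c x : hnorm H (c *: x) ^+ 2 = csqnorm c * hnorm H x ^+ 2.
Proof.
rewrite hnorm_sqr /rip ipZl ipE ipZl ip_self /csqnorm.
by case: c => a b /=; ring.
Qed.

Lemma hnorm_scaler r x : hnorm H (r%:C%C *: x) = `|r| * hnorm H x.
Proof.
apply/eqP; rewrite -(@eqrXn2 _ 2)// ?mulr_ge0// hnorm_sqr_scale exprMn /csqnorm /=.
by rewrite -normrX ger0_norm ?sqr_ge0// expr0n addr0.
Qed.

(** Cauchy-Schwarz: |x + t y|^2 is a quadratic in the real variable [t] that is never negative. *)
Lemma rip_le x y : rip x y <= hnorm H x * hnorm H y.
Proof.
rewrite (le_trans (ler_norm _))// -ler_sqr ?nnegrE ?mulr_ge0//.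
rewrite real_normK ?num_real// exprMn !hnorm_sqr.
apply: quadratic_ge0_discr => [|t]; first by rewrite -hnorm_sqr sqr_ge0.
have := sqr_ge0 (hnorm H (x + t%:C%C *: y)); rewrite hnorm_sqr.
by rewrite !(ripDl, ripDr, ripZl, ripZr) (ripC y x); lra.
Qed.

Lemma normr_rip x y : `|rip x y| <= hnorm H x * hnorm H y.
Proof. by rewrite ler_norml lerNl -ripNl -{1}(hnorm_opp x) !rip_le. Qed.

Lemma hnorm_triangle x y : hnorm H (x + y) <= hnorm H x + hnorm H y.
Proof.
rewrite -ler_sqr ?nnegrE ?addr_ge0// hnorm_sqr sqrrD !hnorm_sqr.
rewrite !(ripDl, ripDr) (ripC y x).
by have := rip_le x y; lra.
Qed.

Lemma hnorm_eq0 x : hnorm H x = 0 -> x = 0.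
Proof. by move=> x0; apply: (ip_eq0 (h := H)); rewrite ip_self x0 expr0n. Qed.

Lemma csqnorm_ge0 c : 0 <= csqnorm c.
Proof. by rewrite addr_ge0 ?sqr_ge0. Qed.

(** The complex Cauchy-Schwarz inequality follows from the real one by pairing [x] with [c *: y] for
    [c = ip H x y], which gives the real number |c|^2. *)
Lemma csqnorm_ip x y : csqnorm (ip H x y) <= (hnorm H x * hnorm H y) ^+ 2.
Proof.
set c := ip H x y.
have e : rip x (c *: y) = csqnorm c.
  by rewrite ripC /rip ipZl ipE -/c /csqnorm; case: (c) => a b /=; ring.
have [->|c0] := eqVneq (csqnorm c) 0; first by rewrite sqr_ge0.
have cp : 0 < csqnorm c by rewrite lt0r c0 csqnorm_ge0.
have := rip_le x (c *: y); rewrite e -ler_sqr ?nnegrE ?mulr_ge0 ?csqnorm_ge0//.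
by rewrite exprMn hnorm_sqr_scale mulrCA expr2 ler_pM2l// exprMn.
Qed.

Lemma Re_ip_mul f x y h : `|complex.Re (ip H f x * ip H y h)| <=
  hnorm H f * hnorm H x * (hnorm H y * hnorm H h).
Proof.
rewrite -ipZl; apply: (le_trans (normr_rip _ _)).
rewrite [leRHS]mulrA ler_wpM2r// -ler_sqr ?nnegrE ?mulr_ge0//.
by rewrite hnorm_sqr_scale exprMn ler_wpM2r ?sqr_ge0// csqnorm_ip.
Qed.

Lemma riesz (l : V -> R) (C : R) :
  (forall x y, l (x + y) = l x + l y) ->
  (forall r x, l (r%:C%C *: x) = r * l x) ->
  (forall x, l x <= C * hnorm H x) ->
  exists g, forall h, rip g h = l h.
Proof.
move=> lD lZ lC.
(* The representer of [l] is the minimiser of [J]. *)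
pose J x := rip x x - 2 * l x.
have JC x : - C ^+ 2 <= J x.
  rewrite /J -hnorm_sqr; have := lC x; have := sqr_ge0 (hnorm H x - C).
  by rewrite sqrrB; lra.
have Jinf : has_inf (range J).
  by split; [exists (J 0), 0|exists (- C ^+ 2) => _ [x _ <-]].
pose m := inf (range J).
have Jm x : m <= J x by apply: ge_inf; [case: Jinf|exists x].
have /choice[u uJ] (n : nat) : exists x, J x < m + n.+1%:R^-1.
  have [|_ [x _ <-] xm] := @inf_adherent _ (range J) n.+1%:R^-1 _ Jinf.
    by rewrite invr_gt0.
  by exists x.
have small (e : R) : 0 < e -> exists N : nat, forall n, (N <= n)%N -> n.+1%:R^-1 < e.
  move=> e0; exists (Num.bound e^-1) => n Nn.
  rewrite invf_plt ?posrE//; apply: (lt_le_trans (archi_boundP _)).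
    by rewrite invr_ge0 ltW.
  by rewrite ler_nat leqW.
(* Parallelogram identity: |u p - u q|^2 = 2 J(u p) + 2 J(u q) - 4 J(midpoint), and [J] is at least
   [m] at the midpoint. So a minimising sequence is Cauchy. *)
have [e e0|g ug] := @ip_complete _ _ H u.
  have [N Nle] := small (e ^+ 2 / 4) ltac:(by rewrite divr_gt0 ?exprn_gt0).
  exists N => p q Np Nq; change (hnorm H (u p - u q) < e).
  rewrite -ltr_sqr ?nnegrE ?(ltW e0)// hnorm_sqr.
  have := Jm (2^-1%:C%C *: (u p + u q)); have := uJ p; have := uJ q.
  have := Nle p Np; have := Nle q Nq; rewrite /J.
  rewrite !(lD, lZ, ripDl, ripDr, ripNl, ripNr, ripZl, ripZr) (ripC (u q) (u p)).
  by move: p.+1%:R^-1 q.+1%:R^-1 (m) => a b m'; lra.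
(* Arguing at nearly minimal points close to [g] avoids proving that [J] is continuous. *)
have near_g (e : R) : 0 < e -> exists2 x, hnorm H (x - g) < e & J x < m + e.
  move=> e0; have [N1 N1P] := ug e e0; have [N2 N2P] := small e e0.
  exists (u (maxn N1 N2)); first by apply: N1P; rewrite leq_maxl.
  by apply: (lt_trans (uJ _)); rewrite ltrD2l N2P// leq_maxr.
exists g => h; apply/eqP; rewrite -subr_eq0 -sqrf_eq0 eq_le sqr_ge0 andbT.
apply/ler_addgt0Pr => e e0; rewrite add0r.
pose k := rip h h + 1; have k0 : 0 < k by rewrite ltr_wpDl// -hnorm_sqr sqr_ge0.
pose e' := Num.min 1 (e / (4 * k)).
have e'0 : 0 < e' by rewrite lt_min ltr01 divr_gt0// mulr_gt0.
have [x xg xm] := near_g e' e'0.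
(* Near-minimality of [x] makes e' + 2t (rip x h - l h) + t^2 rip h h nonnegative for every [t]. *)
have h1 : (rip x h - l h) ^+ 2 <= e' * rip h h.
  apply: quadratic_ge0_discr => [|t]; first by rewrite -hnorm_sqr sqr_ge0.
  have := Jm (x + t%:C%C *: h); rewrite /J in xm *.
  by rewrite !(lD, lZ, ripDl, ripDr, ripZl, ripZr) (ripC h x); lra.
have h2 : rip (x - g) h ^+ 2 <= e' * rip h h.
  rewrite -real_normK ?num_real// -hnorm_sqr.
  apply: (@le_trans _ _ ((hnorm H (x - g) * hnorm H h) ^+ 2)).
    by rewrite ler_sqr ?nnegrE ?mulr_ge0// normr_rip.
  rewrite exprMn ler_wpM2r ?sqr_ge0// expr2 -[leRHS]mulr1 ler_pM ?(ltW xg)//.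
  by rewrite (le_trans (ltW xg))// ge_min lexx.
have h3 : e' * rip h h <= e / 4.
  apply: (@le_trans _ _ (e' * k)); first by rewrite ler_wpM2l ?ltW// /k ltrDl.
  rewrite -ler_pdivlMr// (le_trans (y := e / (4 * k)))// ?ge_min ?lexx ?orbT//.
  by rewrite invfM mulrA.
(* [rip g h - l h] is the difference of the quantities bounded in [h1] and [h2], so its square is at
   most 2 (e/4 + e/4) = e. *)
move: h1 h2; rewrite ripDl ripNl.
have := sqr_ge0 (rip x h - l h + (rip x h + - rip g h)).
by rewrite !sqrrD !sqrrN; nra.
Qed.

Lemma Re_ip_mulB f h x v :
  complex.Re (ip H f x * ip H x h) - complex.Re (ip H f v * ip H v h) =
  complex.Re (ip H f (x - v) * ip H x h) + complex.Re (ip H f v * ip H (x - v) h).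
Proof.
have ReD c c' : complex.Re c + complex.Re c' = complex.Re (c + c').
  by case: c c' => a b [].
apply/eqP; rewrite subr_eq !ReD ipBl ipBr; apply/eqP; congr complex.Re.
by rewrite mulrBl mulrBr -addrA subrK subrK.
Qed.

End RealInnerProduct.

(** * Intermediate values of non-atomic measures *)

Section Sierpinski.
Context {d : measure_display} {X : measurableType d} {R : realType}.
Variables (mu : {measure set X -> \bar R}) (P : set X).
Hypotheses (mP : measurable P) (Pfin : (mu P < +oo)%E) (mu_na : nonatomic mu).
Let m (A : set X) : R := fine (mu A).

Let fin_sub A : measurable A -> A `<=` P -> mu A \is a fin_num.
Proof.
move=> mA AP; rewrite ge0_fin_numE//; apply: le_lt_trans Pfin.
by apply: le_measure; rewrite ?inE.
Qed.

Let mD A C : measurable A -> measurable C -> C `<=` A -> A `<=` P ->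
  m (A `\` C) = m A - m C.
Proof.
move=> mA mC CA AP; have CP := subset_trans CA AP.
rewrite /m measureD//; last by rewrite -ge0_fin_numE// fin_sub.
by rewrite setIidr// fineB// fin_sub.
Qed.

Let m_ge0 A : 0 <= m A.
Proof. exact: fine_ge0. Qed.

Let mS A C : measurable A -> measurable C -> C `<=` A -> A `<=` P -> m C <= m A.
Proof. by move=> mA mC CA AP; rewrite -subr_ge0 -mD. Qed.

Let mU A C : measurable A -> measurable C -> A `<=` P -> C `<=` P `\` A ->
  m (A `|` C) = m A + m C.
Proof.
move=> mA mC AP CPA; rewrite /m measureU//.
  by rewrite fineD ?fin_sub//; move=> x /CPA[].
by rewrite -subset0 => x [Ax /CPA[_]].
Qed.

Let mE A : measurable A -> A `<=` P -> mu A = (m A)%:E.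
Proof. by move=> mA AP; rewrite fineK// fin_sub. Qed.

(** Non-atomicity splits a set of positive measure into two such sets, and the lighter one has at
    most half of the measure. Iterating this gets below [e]. *)
Let small_subset Q (e : R) : measurable Q -> Q `<=` P -> 0 < m Q -> 0 < e ->
  exists B, [/\ measurable B, B `<=` Q, 0 < m B & m B <= e].
Proof.
move=> mQ QP Q0 e0.
have halve n : exists B, [/\ measurable B, B `<=` Q, 0 < m B & m B * 2 ^+ n <= m Q].
  elim: n => [|n [B [mB BQ B0 Bn]]]; first by exists Q; split => //; rewrite expr0 mulr1.
  have BP := subset_trans BQ QP.
  have [|C [mC CB C0 BC0]] := mu_na mB; first by rewrite mE// lte_fin.
  have mBC : measurable (B `\` C) by exact: measurableD.
  have CP := subset_trans CB BP.
  have BCP : B `\` C `<=` P by move=> x [/BP].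
  rewrite mE// lte_fin in C0; rewrite mE// lte_fin in BC0.
  have BCE := mD mB mC CB BP.
  have pow0 : 0 < 2 ^+ n :> R by rewrite exprn_gt0.
  have [h|h] := leP (2 * m C) (m B).
    exists C; split => //; first exact: subset_trans BQ.
    by rewrite exprS mulrA (mulrC (m C)) (le_trans _ Bn)// ler_pM2r.
  exists (B `\` C); split => //; first by move=> x [/BQ].
  by rewrite exprS mulrA (le_trans _ Bn)// ler_pM2r//; lra.
pose n := Num.bound (m Q / e).
have [B [mB BQ B0 Bn]] := halve n; exists B; split => //.
have nQ : m Q < 2 ^+ n * e.
  rewrite -ltr_pdivrMr//; apply: (lt_trans (archi_boundP _)).
    by rewrite divr_ge0// ltW.
  by rewrite -natrX ltr_nat ltn_expl.
have pow0 : 0 < 2 ^+ n :> R by rewrite exprn_gt0.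
by rewrite -(ler_pM2r pow0) (le_trans Bn)// mulrC ltW// mulrC.
Qed.

(* Greedy exhaustion: at each step add a set whose measure is at least half of the
   supremum of what still fits below [a]. *)
Lemma sierpinski (a : R) : 0 <= a -> (a%:E <= mu P)%E ->
  exists E, [/\ measurable E, E `<=` P & mu E = a%:E].
Proof.
move=> a0; rewrite mE// lee_fin => aP.
have m0 : m set0 = 0 by rewrite /m measure0.
pose good B := [/\ measurable B, B `<=` P & m B <= a].
pose fits B C := [/\ measurable C, C `<=` P `\` B & m B + m C <= a].
have /choice[c cP] B : exists C, good B ->
    fits B C /\ forall C', fits B C' -> m C' <= 2 * m C.
  (* Choice needs a value for every [B]; outside [good] the empty set is a mere default. *)
  have [gB|] := pselect (good B); last by exists set0.
  have [mB BP Ba] := gB.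
  have fits0 : fits B set0 by split => //; rewrite m0 addr0.
  pose S := [set m C | C in fits B].
  have supS : has_sup S.
    split; first by exists (m set0), set0.
    exists a => _ [C [_ _ BC] <-]; apply: le_trans BC.
    by rewrite lerDr.
  (* Half of the supremum lies strictly below it only if it is positive; otherwise every fitting set
     is null and the empty set will do. *)
  have [s0|s0] := leP (sup S) 0.
    exists set0 => _; split => // C' fC'; rewrite m0 mulr0.
    by apply: le_trans s0; apply: sup_ubound; [case: supS|exists C'].
  have [|_ [C fC <-] sC] := @sup_adherent _ S (sup S / 2) _ supS.
    by rewrite divr_gt0.
  exists C => _; split=> // C' fC'.
  have : m C' <= sup S by apply: sup_ubound; [case: supS|exists C'].
  by lra.
pose B n := iter n (fun B => B `|` c B) set0.
have gB n : good (B n).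
  elim: n => [|n gBn]; first by split => /=; rewrite ?m0//.
  have [[mC CP Ba] _] := cP _ gBn; have [mB BP _] := gBn.
  split; rewrite ?mU//; first exact: measurableU.
  by move=> x [/BP//|/CP[]].
have BS n : m (B n.+1) = m (B n) + m (c (B n)).
  by have [[mC CP _] _] := cP _ (gB n); have [mB BP _] := gB n; rewrite mU.
pose E := \bigcup_n B n.
have measE : measurable E by apply: bigcupT_measurable => n; case: (gB n).
have EP : E `<=` P by move=> x [n _]; case: (gB n) => _ + _; apply.
have Ea : m E <= a.
  rewrite -lee_fin -mE//.
  have ndB : {homo B : n p / (n <= p)%N >-> (n <= p)%O}.
    by apply/nondecreasing_seqP => n; apply/subsetPset; exact: subsetUl.
  have cB : mu \o B @ \oo --> mu E.
    by apply: nondecreasing_cvg_mu => // n; case: (gB n).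
  rewrite -(cvg_lim _ cB)//; apply: lime_le; first by apply/cvg_ex; exists (mu E).
  by apply: nearW => n; have [mB BP Ba] := gB n; rewrite /= mE// lee_fin.
exists E; split => //; rewrite mE//; congr EFin; apply/eqP.
rewrite eq_le Ea leNgt; apply/negP => Ea'.
(* If [E] fell short of [a], such a [D] outside [E] would fit at every stage. Each step would then
   add at least half of [m D], and [m (B n)] would outgrow [a]. *)
have [|||| D [mD' DP D0 De]] := @small_subset (P `\` E) (a - m E).
- exact: measurableD.
- by move=> x [].
- by rewrite mD//; lra.
- by rewrite subr_gt0.
have DB n : m D <= 2 * m (c (B n)).
  have [_] := cP _ (gB n); apply; split => //.
    by move=> x /DP[Px Ex]; split=> // Bx; apply: Ex; exists n.
  have : m (B n) <= m E by apply: mS => //; [case: (gB n)|move=> x; exists n].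
  by lra.
have BD n : n%:R * m D <= 2 * m (B n).
  elim: n => [|n ih]; first by rewrite mul0r mulr_ge0.
  by rewrite BS -addn1 natrD mulrDl mul1r; have := DB n; lra.
have := archi_boundP (x := 2 * a / m D) ltac:(by rewrite divr_ge0 ?mulr_ge0// ltW).
rewrite ltr_pdivrMr//; have := BD (Num.bound (2 * a / m D)).
by have [_ _] := gB (Num.bound (2 * a / m D)); lra.
Qed.

End Sierpinski.

(** * Integrals of signed functions over countable disjoint unions *)

Section IntegralOverUnion.
Context {d : measure_display} {X : measurableType d} {R : realType}.
Variable mu : {measure set X -> \bar R}.

(** Since [g] may change sign, countable additivity is applied to its positive and negative parts.
    Both integrals are finite, so the bound on partial sums passes to the limit of the
    difference. *)
Lemma integral_bigcup_le (P : nat -> set X) (g : X -> \bar R) (b : \bar R) :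
  trivIset setT P -> (forall k, measurable (P k)) ->
  mu.-integrable (\bigcup_k P k) g ->
  (forall n, \sum_(0 <= k < n) \int[mu]_(t in P k) g t <= b)%E ->
  (\int[mu]_(t in \bigcup_k P k) g t <= b)%E.
Proof.
move=> tP mP ig sb.
have mU : measurable (\bigcup_k P k) by exact: bigcupT_measurable.
have igp := integrable_funepos mU ig; have ign := integrable_funeneg mU ig.
have fp := integrable_fin_num mU igp; have fn := integrable_fin_num mU ign.
have igk k : mu.-integrable (P k) g.
  by apply: integrableS ig => //; exact: bigcup_sup.
have cp : (fun n => \sum_(0 <= k < n) \int[mu]_(t in P k) g^\+ t)%E @ \oo -->
    (\int[mu]_(t in \bigcup_k P k) g^\+ t)%E.
  rewrite ge0_integral_bigcup//; last exact: measurable_int igp.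
  by apply: is_cvg_nneseries => k _ _; exact: integral_ge0.
have cn : (fun n => \sum_(0 <= k < n) \int[mu]_(t in P k) g^\- t)%E @ \oo -->
    (\int[mu]_(t in \bigcup_k P k) g^\- t)%E.
  rewrite ge0_integral_bigcup//; last exact: measurable_int ign.
  by apply: is_cvg_nneseries => k _ _; exact: integral_ge0.
have c := cvgeB (fin_num_adde_defr _ fp) cp cn.
rewrite integralE -(cvg_lim _ (c _))//; apply: lime_le.
  by apply/cvg_ex; eexists; exact: c.
apply: nearW => n; apply: le_trans (sb n).
rewrite -sumeN; last first.
  move=> i j _ _; rewrite fin_num_adde_defl//.
  by apply: integrable_fin_num => //; apply: integrable_funeneg => //; exact: igk.
by rewrite -big_split/=; apply: lee_sum => k _; rewrite [leRHS]integralE.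
Qed.

End IntegralOverUnion.

(** * Frame operators of a continuous Bessel family *)

Section ContinuousFrame.
Context {R : realType} {d : measure_display} {X : measurableType d}.
Context {V : lmodType R[i]}.
Variables (mu : {measure set X -> \bar R}) (H : hilbert_space V) (phi : X -> V).
Hypothesis bessel : bessel_family H mu phi.

Let F f h (t : X) : R := complex.Re (ip H f (phi t) * ip H (phi t) h).

(** [F] is the Euclidean product in the plane of two frame coefficients; measurability, real
    bilinearity and [F_le] are read off from this form. *)
Let FE f h t : F f h t =
  complex.Re (ip H f (phi t)) * complex.Re (ip H h (phi t)) +
  complex.Im (ip H f (phi t)) * complex.Im (ip H h (phi t)).
Proof.
by rewrite /F (ipE H h); case: (ip H f _) (ip H h _) => a b [a' b'] /=; ring.
Qed.

Let measurable_Re f : measurable_fun setT (fun t => complex.Re (ip H f (phi t))).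
Proof. by case: bessel => /(_ f)[]. Qed.

Let measurable_Im f : measurable_fun setT (fun t => complex.Im (ip H f (phi t))).
Proof. by case: bessel => /(_ f)[]. Qed.

Let measurable_F f h : measurable_fun setT (F f h).
Proof.
rewrite (funext (FE f h)); apply: measurable_funD; exact: measurable_funM.
Qed.

Let integrable_csqnorm f :
  mu.-integrable setT (EFin \o (fun t => csqnorm (ip H f (phi t)))).
Proof.
case: bessel => mphi [B BB]; apply/integrableP; split.
  by apply/measurable_EFinP; apply: measurable_funD; apply: measurable_funX.
apply: le_lt_trans (ltry (B * hnorm H f ^+ 2)); apply: le_trans (BB f).
by under eq_integral do rewrite /= ger0_norm ?csqnorm_ge0//.
Qed.

(** With this crude bound, integrability follows from the Bessel inequality. It is not homogeneous
    in [h]; [wF_op] repairs that by normalising [h]. *)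
Let F_le f h t : `|F f h t| <= csqnorm (ip H f (phi t)) + csqnorm (ip H h (phi t)).
Proof.
rewrite FE /csqnorm; case: (ip H f _) (ip H h _) => a b [a' b'] /=.
have := sqr_ge0 (a + a'); have := sqr_ge0 (a - a').
have := sqr_ge0 (b + b'); have := sqr_ge0 (b - b').
have := sqr_ge0 a; have := sqr_ge0 a'; have := sqr_ge0 b; have := sqr_ge0 b'.
by rewrite ler_norml; nra.
Qed.

Let integrable_wF (w : X -> R) f h : measurable_fun setT w -> (forall t, `|w t| <= 1) ->
  mu.-integrable setT (EFin \o (fun t => w t * F f h t)).
Proof.
move=> mw w1.
apply: le_integrable (integrableD _ (integrable_csqnorm f) (integrable_csqnorm h)) => //.
  by apply/measurable_EFinP; exact: measurable_funM.
move=> t _; rewrite /= lee_fin normrM.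
apply: (@le_trans _ _ `|F f h t|); first by rewrite ler_piMl.
by rewrite (le_trans (F_le _ _ _))// ler_norm.
Qed.

(** The frame operators are picked by [xget], which is meaningful only if a representing vector
    exists. The Riesz theorem supplies one for every such weight. *)
Let wF_op (w : X -> R) f : measurable_fun setT w -> (forall t, `|w t| <= 1) ->
  exists g, forall h, ip H g h =
    cintegral mu setT (fun t => (w t)%:C%C * ip H f (phi t) * ip H (phi t) h).
Proof.
move=> mw w1; have iw h := integrable_wF f h mw w1.
pose l h := Rintegral mu setT (fun t => w t * F f h t).
have lD x y : l (x + y) = l x + l y.
  rewrite /l -RintegralD//; apply: eq_Rintegral => t _.
  rewrite !FE ipDl; case: (ip H x _) (ip H y _) => a b [a' b'] /=; ring.
have lZ r x : l (r%:C%C *: x) = r * l x.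
  rewrite /l -RintegralZl//; apply: eq_Rintegral => t _.
  rewrite !FE ipZl; case: (ip H x _) => a b /=; ring.
pose C h := Rintegral mu setT (fun t => csqnorm (ip H h (phi t))).
have lC h : l h <= C f + C h.
  rewrite /l /C -RintegralD//; apply: le_Rintegral => //.
    by apply: (integrableD measurableT (integrable_csqnorm f) (integrable_csqnorm h)).
  move=> t _; rewrite (le_trans (ler_norm _))// normrM.
  apply: (@le_trans _ _ `|F f h t|); first by rewrite ler_piMl.
  exact: F_le.
have [B BB] := bessel.2.
have CB h : C h <= B * hnorm H h ^+ 2.
  rewrite -lee_fin fineK ?BB//.
  exact: (integrable_fin_num measurableT (integrable_csqnorm h)).
have [|g gl] := @riesz R V H l (C f + B) lD lZ.
  move=> h; have [h0|h0] := eqVneq (hnorm H h) 0.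
    have -> : h = (0 : R)%:C%C *: h by rewrite (hnorm_eq0 h0) scaler0.
    by rewrite lZ mul0r hnorm_scaler normr0 mul0r mulr0.
  have hp : 0 < hnorm H h by rewrite lt0r h0 hnorm_ge0.
  (* At the unit vector h / |h| the Bessel bound gives at most [C f + B]; scaling back makes the
     bound linear in |h|. *)
  have := le_trans (lC ((hnorm H h)^-1%:C%C *: h)) (lerD (lexx _) (CB _)).
  rewrite lZ hnorm_scaler ger0_norm ?invr_ge0 ?hnorm_ge0// mulVf// expr1n mulr1.
  by rewrite mulrC ler_pdivrMr.
(* [Re_g] is stated for all [h'] because its instance at i h gives the imaginary part, through
   [Im_ip]. *)
exists g => h; have Re_g h' : complex.Re (ip H g h') =
    Rintegral mu setT (fun t => complex.Re ((w t)%:C%C * ip H f (phi t) * ip H (phi t) h')).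
  rewrite -[LHS]/(rip H g h') gl; apply: eq_Rintegral => t _; rewrite -mulrA /F.
  by case: (ip H f _ * _) => a b /=; rewrite mul0r subr0.
apply/eqP; rewrite eq_complex /cintegral /= Re_g eqxx /= Im_ip /rip Re_g.
apply/eqP; apply: eq_Rintegral => t _.
rewrite (ipE H _ (phi t)) [in RHS](ipE H _ (phi t)) ipZl.
by case: (_ * _) (ip H h _) => a b [a' b'] /=; ring.
Qed.

Let rip_cintegral (w : X -> R) f h :
  complex.Re (cintegral mu setT (fun t => (w t)%:C%C * ip H f (phi t) * ip H (phi t) h)) =
  Rintegral mu setT (fun t => w t * F f h t).
Proof.
apply: eq_Rintegral => t _; rewrite -mulrA /F.
by case: (ip H f _ * _) => a b /=; rewrite mul0r subr0.
Qed.

Lemma rip_weighted_frame_op (tau : X -> R) f h :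
  measurable_fun setT tau -> (forall t, `|tau t| <= 1) ->
  rip H (weighted_frame_op H mu phi tau f) h = Rintegral mu setT (fun t => tau t * F f h t).
Proof.
move=> mt t1; rewrite -rip_cintegral /rip.
by congr complex.Re; move: h; exact: (xgetPex 0 (wF_op f mt t1)).
Qed.

(** Integrating over [E] amounts to using the weight [\1_E] on all of [X]. Both operators then have
    the same weighted form, and their difference has the weight [\1_E - tau]. *)
Lemma rip_partial_frame_op (E : set X) f h : measurable E ->
  rip H (partial_frame_op H mu phi E f) h = Rintegral mu setT (fun t => \1_E t * F f h t).
Proof.
move=> mE; rewrite -rip_cintegral /rip.
have mI : measurable_fun setT (\1_E : X -> R) by exact: measurable_indic.
have I1 t : `|\1_E t : R| <= 1.
  by rewrite indicE; case: (t \in E); rewrite ?normr1// normr0 ler01.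
have cE (u : X -> R[i]) :
    cintegral mu E u = cintegral mu setT (fun t => (\1_E t : R)%:C%C * u t).
  rewrite /cintegral !(Rintegral_mkcond _ E).
  by congr complex.Complex; apply: eq_Rintegral => t _; rewrite patchE indicE;
    case: (t \in E); case: (u t) => a b /=; rewrite ?(mul1r, mul0r, subr0, addr0).
have [g gE] := wF_op f mI I1.
have ex : exists g, forall h,
    ip H g h = cintegral mu E (fun t => ip H f (phi t) * ip H (phi t) h).
  exists g => h'; rewrite gE cE; congr (cintegral mu setT _).
  by apply/funext => t; rewrite mulrA.
rewrite [X in complex.Re X](xgetPex 0 ex) cE; congr (complex.Re (cintegral mu setT _)).
by apply/funext => t; rewrite mulrA.
Qed.

(** [phi] is only assumed weakly measurable; these balls cut out the pieces on which it is bounded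
    or close to a fixed vector. *)
Lemma measurable_ball_frame (v : V) (r : R) : separable H -> 0 <= r ->
  measurable [set t | hnorm H (phi t - v) <= r].
Proof.
move=> [e eP] r0.
(* By density, it suffices to test the norm against countably many vectors. *)
have -> : [set t | hnorm H (phi t - v) <= r] =
    \bigcap_n [set t | complex.Re (ip H (e n) (phi t)) <= r * hnorm H (e n) + rip H v (e n)].
  apply/seteqP; split => [t /= tr n _|t /= tr] /=.
    rewrite -[complex.Re _]/(rip H _ _) ripC -lerBlDr -ripNl -ripDl.
    by rewrite (le_trans (rip_le _ _ _))// ler_wpM2r ?hnorm_ge0.
  set x := phi t - v.
  have xe n : rip H x (e n) <= r * hnorm H (e n).
    by rewrite /x ripDl ripNl lerBlDr ripC; exact: tr.
  rewrite leNgt; apply/negP => rx.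
  have x0 : 0 < hnorm H x by exact: le_lt_trans rx.
  have s0 : 0 < hnorm H x + r by rewrite ltr_pwDl.
  (* Chosen so that k (|x| + r) is half of |x| (|x| - r). Some [e n] within [k] of [x] gives |x|^2
     <= |x| k + r (|x| + k), so this positive number would be at most its half. *)
  pose k := hnorm H x * (hnorm H x - r) / (2 * (hnorm H x + r)).
  have k0 : 0 < k by rewrite divr_gt0 ?mulr_gt0// subr_gt0.
  have [n nk] := eP x k k0.
  have h1 : hnorm H (e n) <= hnorm H x + k.
    have := hnorm_triangle H (e n - x) x; rewrite subrK => /le_trans; apply.
    by rewrite addrC lerD2l hnorm_subC ltW.
  have h2 : rip H x x <= hnorm H x * k + r * (hnorm H x + k).
    rewrite -{2}(subrK (e n) x) ripDr lerD//.
      by rewrite (le_trans (rip_le _ _ _))// ler_wpM2l ?hnorm_ge0// ltW.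
    by rewrite (le_trans (xe n))// ler_wpM2l.
  have kE : k * (hnorm H x + r) = hnorm H x * (hnorm H x - r) / 2.
    by rewrite /k; field; rewrite gt_eqF.
  move: h2; rewrite -hnorm_sqr.
  have : 0 < hnorm H x * (hnorm H x - r) by rewrite mulr_gt0// subr_gt0.
  by lra.
apply: bigcapT_measurable => n.
have := measurable_Re (e n) measurableT
  (measurable_itv `]-oo, (r * hnorm H (e n) + rip H v (e n))]).
rewrite setTI; congr measurable.
Qed.

(** * Choice of [E]: local approximation, gluing, and passage to the operator norm *)

Section Approximation.
Variable tau : X -> R.
Hypotheses (measurable_tau : measurable_fun setT tau) (tau01 : forall t, 0 <= tau t <= 1).

(* The integrals are not put in absolute value: replacing [h] by [- h] changes their sign. *)
Definition approx_on (P : set X) (b : \bar R) : Prop :=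
  exists E, [/\ measurable E, E `<=` P & forall f h,
    (\int[mu]_(t in P) ((\1_E t - tau t) * F f h t)%:E <=
       b * (hnorm H f * hnorm H h)%:E)%E].

Let w_le1 (E : set X) t : `|\1_E t - tau t| <= 1.
Proof.
have /andP[t0 t1] := tau01 t; rewrite indicE ler_norml.
by case: (t \in E) => /=; lra.
Qed.

Let measurable_w (E : set X) : measurable E ->
  measurable_fun setT (fun t => \1_E t - tau t).
Proof. by move=> mE; apply: measurable_funB => //; exact: measurable_indic. Qed.

Let integrable_w (E P : set X) f h : measurable E -> measurable P ->
  mu.-integrable P (EFin \o (fun t => (\1_E t - tau t) * F f h t)).
Proof.
move=> mE mP; apply: (@integrableS _ _ _ _ setT) => //.
by apply: integrable_wF => //; exact: measurable_w.
Qed.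

Lemma approx_on_le P b c : (b <= c)%E -> approx_on P b -> approx_on P c.
Proof.
move=> bc [E [mE EP Eb]]; exists E; split => // f h; apply: le_trans (Eb f h) _.
by rewrite lee_wpmul2r// lee_fin mulr_ge0// hnorm_ge0.
Qed.

(** By disjointness the union of all [E j] meets [P k] exactly in [E k], so the integrals over the
    pieces are unchanged and the errors add up. *)
Lemma approx_on_bigcup (P : nat -> set X) (b : nat -> \bar R) :
  trivIset setT P -> (forall k, measurable (P k)) -> (forall k, 0 <= b k)%E ->
  (forall k, approx_on (P k) (b k)) -> approx_on (\bigcup_k P k) (\sum_(k <oo) b k).
Proof.
move=> tP mP b0 /choice[E EP].
have mE k : measurable (E k) by have [] := EP k.
have EsubP k : E k `<=` P k by have [] := EP k.
have mU : measurable (\bigcup_k E k) by exact: bigcupT_measurable.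
exists (\bigcup_k E k); split => // [t [k _ /EsubP Pt]|f h]; first by exists k.
have K0 : 0 <= hnorm H f * hnorm H h by rewrite mulr_ge0// hnorm_ge0.
apply: integral_bigcup_le => //.
  by apply: integrable_w => //; exact: bigcupT_measurable.
move=> n; apply: (@le_trans _ _ (\sum_(0 <= k < n) b k * (hnorm H f * hnorm H h)%:E)%E).
  apply: lee_sum => k _; have [_ _ /(_ f h)] := EP k; apply: le_trans.
  rewrite le_eqVlt; apply/orP; left; apply/eqP; apply: eq_integral => t /set_mem Pt.
  have [Et|nEt] := pselect (E k t).
    by rewrite !indicE !mem_set//; exists k.
  rewrite !indicE !memNset// => -[j _ Ej]; apply: nEt.
  by rewrite (tP k j)//; exists t; split => //; exact: EsubP.
rewrite -ge0_sume_distrl//; apply: lee_wpmul2r; first by rewrite lee_fin.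
exact: nneseries_lim_ge.
Qed.

(** The constant: replacing [phi t] by [v] changes [F f h t] by at most |phi t - v| (|phi t| + |v|)
    |f| |h|, and |v| <= M + r. *)
Lemma approx_on_near (P : set X) (v : V) (r M : R) : nonatomic mu ->
  measurable P -> (mu P < +oo)%E ->
  (forall t, P t -> hnorm H (phi t - v) <= r) -> (forall t, P t -> hnorm H (phi t) <= M) ->
  approx_on P ((r * (2 * M + r))%:E * mu P).
Proof.
move=> na mP Pfin Pr PM.
have finP : mu P \is a fin_num by rewrite ge0_fin_numE.
have icst (k : R) : mu.-integrable P (EFin \o cst k).
  by apply: measurable_bounded_integrable => //; exact: bounded_cst.
have itau : mu.-integrable P (EFin \o tau).
  apply: le_integrable (icst 1) => //.
    by apply/measurable_EFinP; exact: measurable_funTS.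
  by move=> t _; have /andP[t0 t1] := tau01 t; rewrite /= lee_fin normr1 ger0_norm.
(* The measure that [E] must have; it lies between 0 and [mu P] because [tau] takes values in
   [0, 1]. *)
pose a := Rintegral mu P tau.
have a0 : 0 <= a.
  rewrite /a -(mul0r (fine (mu P))) -Rintegral_cst//.
  by apply: le_Rintegral => // [|t _]; [exact: icst|have /andP[] := tau01 t].
have aP : (a%:E <= mu P)%E.
  rewrite -[leRHS]fineK// lee_fin -[leRHS]mul1r -Rintegral_cst//.
  by apply: le_Rintegral => // [|t _]; [exact: icst|have /andP[] := tau01 t].
have [E [mE EP muE]] := sierpinski mP Pfin na a0 aP.
exists E; split => // f h.
have iI : mu.-integrable P (EFin \o (\1_E : X -> R)).
  apply: le_integrable (icst 1) => //.
    by apply/measurable_EFinP; apply: measurable_funTS; exact: measurable_indic.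
  move=> t _; rewrite /= lee_fin normr1 indicE.
  by case: (t \in E); rewrite ?normr1// normr0.
have iw : mu.-integrable P (EFin \o (fun t => \1_E t - tau t)).
  exact: (integrableB mP iI itau).
have w0 : Rintegral mu P (fun t => \1_E t - tau t) = 0.
  rewrite RintegralB// [X in X - _](_ : _ = a) ?subrr//.
  by rewrite /Rintegral integral_indic// setIidl// muE.
(* The integrand frozen at [v]: being constant in [t], it integrates to 0 against [\1_E - tau] by
   [w0]. *)
pose G := complex.Re (ip H f v * ip H v h).
pose K := r * (2 * M + r) * (hnorm H f * hnorm H h).
have iGw : mu.-integrable P (EFin \o (fun t => G * (\1_E t - tau t))).
  exact: (integrableZl mP G iw).
have FG t : P t -> `|F f h t - G| <= K.
  move=> Pt; have r1 := Pr t Pt; have M1 := PM t Pt.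
  have M0 := le_trans (hnorm_ge0 H _) M1; have r0 := le_trans (hnorm_ge0 H _) r1.
  have vM : hnorm H v <= M + r.
    have := hnorm_triangle H (phi t) (v - phi t).
    rewrite addrC subrK hnorm_subC => /le_trans; apply.
    exact: lerD.
  rewrite /F /G Re_ip_mulB.
  apply: (le_trans (ler_normD _ _)).
  apply: (le_trans (lerD (Re_ip_mul _ _ _ _ _) (Re_ip_mul _ _ _ _ _))).
  rewrite (_ : _ + _ = hnorm H (phi t - v) * (hnorm H (phi t) + hnorm H v) *
    (hnorm H f * hnorm H h)); last by ring.
  rewrite /K ler_wpM2r ?mulr_ge0 ?hnorm_ge0// ler_pM ?addr_ge0 ?hnorm_ge0//.
  by lra.
have le : Rintegral mu P (fun t => (\1_E t - tau t) * F f h t) <=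
    Rintegral mu P (fun t => G * (\1_E t - tau t) + cst K t).
  apply: le_Rintegral => //; first exact: integrable_w.
    exact: (integrableD mP iGw (icst K)).
  move=> t Pt; rewrite -lerBlDl [leLHS](_ : _ = (\1_E t - tau t) * (F f h t - G)); last by ring.
  rewrite (le_trans (ler_norm _))// normrM (le_trans _ (FG t Pt))//.
  by rewrite ler_piMl.
rewrite -[leLHS]fineK; last exact: (integrable_fin_num mP (integrable_w f h mE mP)).
rewrite -[mu P]fineK// -!EFinM lee_fin; apply: (le_trans le).
rewrite RintegralD// RintegralZl// w0 mulr0 add0r Rintegral_cst// /K.
by rewrite le_eqVlt; apply/orP; left; apply/eqP; ring.
Qed.

(** The error on a piece is its measure times a factor common to all pieces, so countably many
    pieces cost only that factor times [mu P]. *)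
Lemma approx_on_bounded (P : set X) (M eps : R) : nonatomic mu -> separable H ->
  measurable P -> (mu P < +oo)%E -> 0 <= M -> (forall t, P t -> hnorm H (phi t) <= M) ->
  0 < eps -> approx_on P eps%:E.
Proof.
move=> na sep mP Pfin M0 PM eps0; have [e eP] := sep.
have finP : mu P \is a fin_num by rewrite ge0_fin_numE.
pose m := fine (mu P); have m0 : 0 <= m by exact: fine_ge0.
(* The minimum with 1 bounds [2 * M + r] by [2 * M + 1]; [m + 1] keeps the denominator positive when
   [P] is null. *)
pose r := Num.min 1 (eps / ((2 * M + 1) * (m + 1))).
have r0 : 0 < r by rewrite lt_min ltr01 divr_gt0// mulr_gt0// ltr_wpDl// mulr_ge0.
pose c := r * (2 * M + r).
have c0 : 0 <= c by rewrite mulr_ge0 ?addr_ge0 ?mulr_ge0// ltW.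
have cm : c * m <= eps.
  apply: (@le_trans _ _ (r * ((2 * M + 1) * (m + 1)))).
    rewrite /c -mulrA ler_wpM2l ?(ltW r0)// ler_pM ?addr_ge0 ?mulr_ge0 ?(ltW r0)//.
      by rewrite lerD2l ge_min lexx.
    by rewrite lerDl.
  rewrite -ler_pdivlMr ?ge_min ?lexx ?orbT//.
  by rewrite mulr_gt0// ltr_wpDl// mulr_ge0.
pose Q n := P `&` [set t | hnorm H (phi t - e n) <= r].
have mQ n : measurable (Q n).
  by apply: measurableI => //; apply: measurable_ball_frame => //; exact: ltW.
have PQ : \bigcup_n seqDU Q n = P.
  rewrite -seqDU_bigcup_eq; apply/seteqP; split => [t [n _ []]//|t Pt].
  by have [n nr] := eP (phi t) r r0; exists n => //; split => //; exact: ltW.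
have mD n : measurable (seqDU Q n) by exact: seqDU_measurable.
have DP n : seqDU Q n `<=` P by rewrite -[X in _ `<=` X]PQ; exact: bigcup_sup.
rewrite -PQ; apply: (@approx_on_le _ (\sum_(n <oo) c%:E * mu (seqDU Q n))%E).
  rewrite nneseriesZl//.
  have <- : mu P = (\sum_(n <oo) mu (seqDU Q n))%E.
    by rewrite -{1}PQ measure_bigcup//; apply: eq_eseriesl => n; rewrite in_setT.
  by rewrite -[mu P]fineK// -EFinM lee_fin.
apply: approx_on_bigcup => // [n|n]; first by rewrite mule_ge0// lee_fin.
apply: (@approx_on_near _ (e n)) => //.
- by apply: le_lt_trans Pfin; apply: le_measure; rewrite ?inE.
- by move=> t /(@subset_seqDU _ Q n)[].
- by move=> t /DP; exact: PM.
Qed.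

(** Sets of finite measure on which |phi t| <= n exhaust [X]. The piece of index [n] is allotted the
    error eps / 2^(n+1). *)
Lemma approx_on_setT (eps : R) : nonatomic mu -> separable H -> sigma_finite setT mu ->
  0 < eps -> approx_on setT eps%:E.
Proof.
move=> na sep /sigma_finiteP[S [ST ndS mS]] eps0.
pose Q n := S n `&` [set t | hnorm H (phi t - 0) <= n%:R].
have mQ n : measurable (Q n).
  by apply: measurableI; [case: (mS n)|exact: measurable_ball_frame].
have QT : \bigcup_n seqDU Q n = setT.
  rewrite -seqDU_bigcup_eq; apply/seteqP; split => // t _.
  have [k _ Skt] : (\bigcup_n S n) t by rewrite -ST.
  pose n := Num.bound (hnorm H (phi t)).
  (* [S] increases, so membership in [S k] and the norm bound both persist at the larger index. *)
  exists (maxn k n) => //; split => /=.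
    by have /subsetPset := ndS _ _ (leq_maxl k n); apply.
  rewrite subr0 (le_trans (ltW (archi_boundP (hnorm_ge0 _ _))))//.
  by rewrite ler_nat leq_maxr.
rewrite -QT; apply: (@approx_on_le _ (\sum_(n <oo) (eps / (2 ^ n.+1)%:R)%:E)%E).
  exact: (epsilon_trick0 xpredT (ltW eps0)).
apply: approx_on_bigcup => // [n|n|n].
- exact: seqDU_measurable.
- by rewrite lee_fin divr_ge0// ltW.
- apply: (@approx_on_bounded _ n%:R) => //.
  + exact: seqDU_measurable.
  + apply: (@le_lt_trans _ _ (mu (S n))); last by case: (mS n).
    apply: le_measure; rewrite ?inE; first exact: seqDU_measurable.
      by case: (mS n).
    by move=> t /(@subset_seqDU _ Q n)[].
  + by move=> t /(@subset_seqDU _ Q n)[_]; rewrite /= subr0.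
  + by rewrite divr_gt0// ltr0n expn_gt0.
Qed.

(** Testing the difference vector [T] at [f] against [h = T] gives |T|^2 <= b |f| |T|, and |T|
    cancels unless it is 0. *)
Lemma opnorm_frame_op_le (b : R) : 0 <= b -> approx_on setT b%:E ->
  exists E, measurable E /\ (opnorm H (fun f =>
    (partial_frame_op H mu phi E f - weighted_frame_op H mu phi tau f)%R) <= b%:E)%E.
Proof.
move=> b0 [E [mE _ Eb]]; exists E; split => //.
apply: ge_ereal_sup => _ [f /= f1 <-]; rewrite lee_fin.
set T := (X in hnorm H X); have t1 t : `|tau t| <= 1.
  by have /andP[t0 ?] := tau01 t; rewrite ger0_norm.
have : hnorm H T ^+ 2 <= b * (hnorm H f * hnorm H T).
  rewrite hnorm_sqr {1}/T ripDl ripNl rip_partial_frame_op// rip_weighted_frame_op//.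
  rewrite -RintegralB//.
  - under eq_Rintegral do rewrite -mulrBl.
    rewrite -lee_fin fineK; first by rewrite EFinM; exact: Eb.
    exact: (integrable_fin_num measurableT (integrable_w f T mE measurableT)).
  - apply: (@integrable_wF \1_E) => [|t]; first exact: measurable_indic.
    by rewrite indicE; case: (t \in E); rewrite ?normr1// normr0 ler01.
  - exact: integrable_wF.
have [->|T0] := eqVneq (hnorm H T) 0; first by [].
have Tp : 0 < hnorm H T by rewrite lt0r T0 hnorm_ge0.
rewrite expr2 mulrA ler_pM2r// => /le_trans; apply.
by rewrite -[leRHS]mulr1 ler_wpM2l.
Qed.

End Approximation.

End ContinuousFrame.

Theorem theorem3p3 (R : realType) (d : measure_display) (X : measurableType d)
    (mu : {measure set X -> \bar R}) (V : lmodType R[i]) (H : hilbert_space V)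
    (phi : X -> V) :
  nonatomic mu -> sigma_finite setT mu -> separable H -> bessel_family H mu phi ->
  forall tau : X -> R, measurable_fun setT tau -> (forall t : X, 0 <= tau t <= 1) ->
  forall eps : R, 0 < eps ->
  exists E : set X, measurable E /\
    (opnorm H (fun f => (partial_frame_op H mu phi E f - weighted_frame_op H mu phi tau f)%R)
       < eps%:E)%E.
Proof.
move=> na sf sep bessel tau mtau tau01 eps eps0.
(* The bound on the operator norm is not strict; halving [eps] makes it so. *)
have eps2 : 0 < eps / 2 by rewrite divr_gt0.
have [E [mE Ele]] := opnorm_frame_op_le bessel mtau tau01 (ltW eps2)
  (approx_on_setT bessel mtau tau01 na sep sf eps2).
exists E; split => //; apply: le_lt_trans Ele _.
by rewrite lte_fin; lra.
Qed.
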